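(* Let $p=3$ and let $\Phi:U^{(1)}-U^{(2)}\to 3\mathbb{Z}_3\cup(1+3\mathbb{Z}_3)$ be the fixed-point homeomorphism, which takes $4+9\mathbb{Z}_3$ onto $1+3\mathbb{Z}_3$ and $7+9\mathbb{Z}_3$ onto $3\mathbb{Z}_3$. Define $F,G:\mathbb{Z}_3\to\mathbb{Z}_3$ by $$F(x)=\tfrac13\big(\Phi(4+9x)-1\big),\qquad G(x)=\tfrac13\,\Phi(7+9x).$$ Then $F$ and $G$ are isometries of $\mathbb{Z}_3$ with its $3$-adic metric.
   Context: $\mathbb{Z}_3$ is the ring of $3$-adic integers, $U^{(m)}=1+3^m\mathbb{Z}_3$, so $U^{(1)}-U^{(2)}=(4+9\mathbb{Z}_3)\cup(7+9\mathbb{Z}_3)$. For $q\in U^{(1)}$, $\iota_q:\mathbb{Z}_3\to\mathbb{Z}_3$ is the unique continuous function with $\iota_q(n)=1+q+\cdots+q^{n-1}$ for all integers $n\ge 0$; thus $\iota_q(z)=(q^z-1)/(q-1)$ for $q\ne 1$. The fixed points $0,1$ of $\iota_q$ are called trivial. There are unique elements $q_0\equiv 7\pmod 9$ and $q_1\equiv 4\pmod 9$ in $U^{(1)}-U^{(2)}$ such that $\iota_{q_0},\iota_{q_1}$ have no nontrivial fixed points in $\mathbb{Z}_3$; every other $q\in U^{(1)}-U^{(2)}$ has exactly one nontrivial fixed point $z_q\in\mathbb{Z}_3$. The map $\Phi$ is defined by $\Phi(q)=z_q$ for $q\notin\{q_0,q_1\}$, $\Phi(q_0)=0$, $\Phi(q_1)=1$;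 it is a homeomorphism onto $3\mathbb{Z}_3\cup(1+3\mathbb{Z}_3)$ with the mapping properties stated (results of the same paper). An isometry is a (surjective) distance-preserving map. *)

(* Defs.v *)
From HB Require Import structures.
From mathcomp Require Import all_boot all_order all_algebra.
From mathcomp Require Import boolp classical_sets functions topology.

Set Implicit Arguments.
Unset Strict Implicit.
Unset Printing Implicit Defensive.

Import Order.TTheory GRing.Theory Num.Theory.

Local Open Scope classical_set_scope.
Local Open Scope ring_scope.

(* The inverse limit of the rings Z/3^n: [z3res x n] is the representative of
   x mod 3^n in [0, 3^n), the bounds being forced by [z3resP]. *)
Record Z3 := MkZ3 {
  z3res :> nat -> int;
  z3resP : forall n, z3res n = (z3res n.+1 %% 3 ^+ n)%Z
}.

HB.instance Definition _ := gen_eqMixin Z3.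
HB.instance Definition _ := gen_choiceMixin Z3.

Lemma z3_inj (x y : Z3) : (forall n, x n = y n) -> x = y.
Proof.
case: x y => [x xP] [y yP] /= xy.
have e : x = y by apply/funext.
by case: _ / e yP => yP; congr MkZ3; apply: Prop_irrelevance.
Qed.

Lemma z3modS (a : int) n : ((a %% 3 ^+ n.+1)%Z %% 3 ^+ n)%Z = (a %% 3 ^+ n)%Z.
Proof.
by rewrite {2}(divz_eq a (3 ^+ n.+1)) exprS mulrA modzMDl.
Qed.

Lemma z3res_small (x : Z3) n : (x n %% 3 ^+ n)%Z = x n.
Proof. by rewrite (z3resP x n) modz_mod. Qed.

Lemma z3_const_proof (a : int) n :
  (a %% 3 ^+ n)%Z = ((a %% 3 ^+ n.+1)%Z %% 3 ^+ n)%Z.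
Proof. by rewrite z3modS. Qed.
Definition z3_const (a : int) : Z3 := MkZ3 (z3_const_proof a).

Lemma z3_add_proof (x y : Z3) n :
  ((x n + y n) %% 3 ^+ n)%Z
  = (((x n.+1 + y n.+1) %% 3 ^+ n.+1)%Z %% 3 ^+ n)%Z.
Proof. by rewrite z3modS (z3resP x) (z3resP y) modzDm. Qed.
Definition z3_add (x y : Z3) : Z3 := MkZ3 (z3_add_proof x y).

Lemma z3_opp_proof (x : Z3) n :
  ((- x n) %% 3 ^+ n)%Z = (((- x n.+1) %% 3 ^+ n.+1)%Z %% 3 ^+ n)%Z.
Proof. by rewrite z3modS (z3resP x) modzNm. Qed.
Definition z3_opp (x : Z3) : Z3 := MkZ3 (z3_opp_proof x).

Lemma z3_mul_proof (x y : Z3) n :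
  ((x n * y n) %% 3 ^+ n)%Z
  = (((x n.+1 * y n.+1) %% 3 ^+ n.+1)%Z %% 3 ^+ n)%Z.
Proof. by rewrite z3modS (z3resP x) (z3resP y) modzMm. Qed.
Definition z3_mul (x y : Z3) : Z3 := MkZ3 (z3_mul_proof x y).

Lemma z3_addA : associative z3_add.
Proof. by move=> x y z; apply: z3_inj => n /=; rewrite modzDml modzDmr addrA. Qed.

Lemma z3_addC : commutative z3_add.
Proof. by move=> x y; apply: z3_inj => n /=; rewrite addrC. Qed.

Lemma z3_add0 : left_id (z3_const 0) z3_add.
Proof. by move=> x; apply: z3_inj => n /=; rewrite modzDml add0r z3res_small. Qed.

Lemma z3_addN : left_inverse (z3_const 0) z3_opp z3_add.
Proof. by move=> x; apply: z3_inj => n /=; rewrite modzDml addNr. Qed.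

HB.instance Definition _ :=
  GRing.isZmodule.Build Z3 z3_addA z3_addC z3_add0 z3_addN.

Lemma z3_mulA : associative z3_mul.
Proof. by move=> x y z; apply: z3_inj => n /=; rewrite modzMml modzMmr mulrA. Qed.

Lemma z3_mulC : commutative z3_mul.
Proof. by move=> x y; apply: z3_inj => n /=; rewrite mulrC. Qed.

Lemma z3_mul1 : left_id (z3_const 1) z3_mul.
Proof. by move=> x; apply: z3_inj => n /=; rewrite modzMml mul1r z3res_small. Qed.

Lemma z3_mulDl : left_distributive z3_mul z3_add.
Proof. by move=> x y z; apply: z3_inj => n /=; rewrite modzMml modzDm mulrDl. Qed.

Lemma z3_one_neq0 : z3_const 1 != z3_const 0.
Proof. by apply/eqP => /(congr1 (fun x : Z3 => x 1)). Qed.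

HB.instance Definition _ := GRing.Zmodule_isComNzRing.Build Z3
  z3_mulA z3_mulC z3_mul1 z3_mulDl z3_one_neq0.

(* The 3-adic absolute value: 3^(-v) for x <> 0, where v is the least index with
   x nonzero mod 3^(v+1), i.e. the 3-adic valuation of x. *)
Definition z3abs (x : Z3) : rat :=
  if pselect (exists n, x n.+1 != 0) is left x_neq0
  then 3 ^- ex_minn x_neq0 else 0.

Lemma z3res0 (x : Z3) : x 0 = 0.
Proof. by rewrite z3resP expr0 modz1. Qed.

Lemma z3abs_cases (x : Z3) :
  (x = 0 /\ z3abs x = 0) \/
  exists n, [/\ x n = 0, x n.+1 != 0 & z3abs x = 3 ^- n].
Proof.
rewrite /z3abs; case: pselect => [xn|x0]; [right|left].
  case: ex_minnP => -[|n] xSn mn; [exists 0|exists n.+1]; split=> //.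
    exact: z3res0.
  by apply/eqP; apply: contraT => /mn; rewrite ltnn.
split=> //; apply: z3_inj => -[|n]; first by rewrite !z3res0.
rewrite /= mod0z; apply/eqP; apply: contraT => h.
by case: x0; exists n.
Qed.

Lemma z3res_eq0_le (x : Z3) m n : (m <= n)%N -> x n = 0 -> x m = 0.
Proof.
move=> /subnK <-; elim: (n - m)%N => [|k IHk] // xk.
by apply: IHk; rewrite z3resP -addSn xk mod0z.
Qed.

Lemma z3abs_le (x : Z3) n : (z3abs x <= 3 ^- n) = (x n == 0).
Proof.
case: (z3abs_cases x) => [[-> ->]|[m [xm xSm ->]]].
  by rewrite /= mod0z eqxx invr_ge0 exprn_ge0.
rewrite lef_pV2 ?posrE ?exprn_gt0// ler_eXn2l//.
apply/idP/eqP => [nm|xn]; first exact: z3res_eq0_le xm.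
by rewrite leqNgt; apply: contra xSm => mn; apply/eqP; exact: z3res_eq0_le xn.
Qed.

Lemma z3abs_ge0 (x : Z3) : 0 <= z3abs x.
Proof.
by case: (z3abs_cases x) => [[_ ->]|[n [_ _ ->]]] //; rewrite invr_ge0 exprn_ge0.
Qed.

Lemma z3abs_eq0 (x : Z3) : z3abs x = 0 -> x = 0.
Proof.
case: (z3abs_cases x) => [[]|[n [_ _ ->]]] // /eqP.
by rewrite invr_eq0 expf_eq0 andbF.
Qed.

Lemma z3abs0 : z3abs 0 = 0.
Proof. by case: (z3abs_cases 0) => [[]|[n [_ ]]] //=; rewrite mod0z eqxx. Qed.

Lemma z3absN_le (x : Z3) : z3abs (- x) <= z3abs x.
Proof.
case: (z3abs_cases x) => [[-> ->]|[n [xn _ ->]]]; first by rewrite oppr0 z3abs0.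
by rewrite z3abs_le /= xn oppr0 mod0z.
Qed.

Lemma z3absN (x : Z3) : z3abs (- x) = z3abs x.
Proof. by apply/le_anti; rewrite z3absN_le -{1}(opprK x) z3absN_le. Qed.

Lemma z3absD (x y : Z3) : z3abs (x + y) <= z3abs x + z3abs y.
Proof.
case: (z3abs_cases x) => [[-> ->]|[m [xm _ ex]]]; first by rewrite !add0r.
case: (z3abs_cases y) => [[-> ->]|[n [yn _ ey]]]; first by rewrite !addr0.
case: (leqP m n) => [mn|/ltnW nm].
  apply: le_trans (_ : z3abs x <= _); last by rewrite lerDl z3abs_ge0.
  by rewrite ex z3abs_le /= xm (z3res_eq0_le mn yn) addr0 mod0z.
apply: le_trans (_ : z3abs y <= _); last by rewrite lerDr z3abs_ge0.
by rewrite ey z3abs_le /= yn (z3res_eq0_le nm xm) addr0 mod0z.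
Qed.

Definition z3dist (x y : Z3) : rat := z3abs (x - y).

Lemma z3distxx x : z3dist x x = 0.
Proof. by rewrite /z3dist subrr z3abs0. Qed.

Lemma z3dist_positivity x y : z3dist x y = 0 -> x = y.
Proof. by move=> /z3abs_eq0/eqP; rewrite subr_eq0 => /eqP. Qed.

Lemma z3dist_sym x y : z3dist x y = z3dist y x.
Proof. by rewrite /z3dist -z3absN opprB. Qed.

Lemma z3dist_triangle y x z : z3dist x z <= z3dist x y + z3dist y z.
Proof. by rewrite /z3dist -(subrKA y) z3absD. Qed.

(* The metric is rat-valued, as the values of the 3-adic absolute value are
   0 and the powers of 3. *)
HB.instance Definition _ := isMetric.Build rat Z3
  z3distxx z3dist_positivity z3dist_sym z3dist_triangle.

Definition isometry (K : numDomainType) (X Y : metricType K) (f : X -> Y) :=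
  set_surj [set: X] [set: Y] f /\
  (forall x y : X, mdist (f x) (f y) = mdist x y).

(* The coset a + 3^m Z_3. *)
Definition coset3 (a : Z3) (m : nat) : set Z3 :=
  [set a + 3 ^+ m * x | x in [set: Z3]].

Definition U (m : nat) : set Z3 := coset3 1 m.

(* The unique continuous function extending n |-> 1 + q + ... + q^(n-1); it
   exists for q in U 1, the only case used below. *)
Definition iota3 (q : Z3) : Z3 -> Z3 :=
  xget (fun=> 0) [set f : Z3 -> Z3 |
    continuous f /\ forall n : nat, f n%:R = \sum_(i < n) q ^+ i].

Definition nontrivial_fixed_points (q : Z3) : set Z3 :=
  [set z | iota3 q z = z /\ z <> 0 /\ z <> 1].

(* The unique q in U^(1) - U^(2) with q = a mod 9 and iota3 q having no
   nontrivial fixed point; it exists for a = 7 and a = 4. *)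
Definition exceptional (a : Z3) : Z3 :=
  xget 0 [set q | (U 1 `\` U 2) q /\ coset3 a 2 q /\
                  nontrivial_fixed_points q = set0].

Definition q0 : Z3 := exceptional 7.
Definition q1 : Z3 := exceptional 4.

(* Meaningful on U^(1) - U^(2) only; for q different from q0 and q1 there, the
   set of nontrivial fixed points is a singleton. *)
Definition Phi (q : Z3) : Z3 :=
  if q == q0 then 0 else if q == q1 then 1
  else xget 0 (nontrivial_fixed_points q).

(* Exact division by 3: the unique y with 3 y = x, for x in 3 Z_3. *)
Definition div3 (x : Z3) : Z3 := xget 0 [set y | 3 * y = x].

Definition F (x : Z3) : Z3 := div3 (Phi (4 + 9 * x) - 1).
Definition G (x : Z3) : Z3 := div3 (Phi (7 + 9 * x)).

(* Main.v *)
From mathcomp Require Import all_boot all_order all_algebra.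
From mathcomp Require Import boolp classical_sets functions topology.
From mathcomp Require Import ring.
Require Import Defs.

(* Write q = 1 + 3u with u a unit.  The binomial series gives
     iota_q(z) = z + 3u z(z-1) h(z,u),
     h(z,u) = sum_(j >= 0) 3^j / (j+2)! (z-2)(z-3)...(z-1-j) u^j,
   and v_3((j+2)!) <= (j+1)/2 shows that h is a 3-adically convergent series
   with 2 h(z,u) = 1 + (z-2)u + 3 r(z,u), where r respects congruences mod 3^n
   in both variables.  Nontrivial fixed points of iota_q are thus zeros of
   h(.,u), and h(z,u) = 0 reads (z-2)u = -1 - 3 r(z,u), an equation in which both z-2
   and u are units.  As a contraction it can be solved uniquely for z and for u,
   and inductively two solutions satisfy z = z' mod 3^n iff u = u' mod 3^n.  The
   exceptional q_0 and q_1 are those whose zero z is 0 or 1, so Phi(1+3u) is in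
   all cases the zero of h(.,u). *)

Set Implicit Arguments.
Unset Strict Implicit.
Unset Printing Implicit Defensive.

Import Order.TTheory GRing.Theory Num.Theory.

Local Open Scope classical_set_scope.
Local Open Scope ring_scope.

(** * Congruences modulo powers of 3, and exact division by 3 *)

Lemma z3_congrD (x x' y y' : Z3) n :
  x n = x' n -> y n = y' n -> (x + y) n = (x' + y') n.
Proof. by move=> /= -> ->. Qed.

Lemma z3_congrN (x x' : Z3) n : x n = x' n -> (- x) n = (- x') n.
Proof. by move=> /= ->. Qed.

Lemma z3_congrM (x x' y y' : Z3) n :
  x n = x' n -> y n = y' n -> (x * y) n = (x' * y') n.
Proof. by move=> /= -> ->. Qed.

Lemma z3_congrX (x x' : Z3) k n : x n = x' n -> (x ^+ k) n = (x' ^+ k) n.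
Proof.
by move=> xx'; elim: k => [|k IHk] //; rewrite !exprS; apply: z3_congrM.
Qed.

Lemma z3_congr_sum (I : finType) (f g : I -> Z3) n :
  (forall i, f i n = g i n) -> (\sum_i f i) n = (\sum_i g i) n.
Proof.
move=> fg; elim/big_rec2: _ => [|i x y _ xy] //.
exact: z3_congrD.
Qed.

Lemma z3_congr_prod (I : finType) (f g : I -> Z3) n :
  (forall i, f i n = g i n) -> (\prod_i f i) n = (\prod_i g i) n.
Proof.
move=> fg; elim/big_rec2: _ => [|i x y _ xy] //.
exact: z3_congrM.
Qed.

Lemma z3_0 n : (0 : Z3) n = 0.
Proof. by rewrite /= mod0z. Qed.

Lemma z3_subr_eq0 (x y : Z3) n : (x - y) n = 0 <-> x n = y n.
Proof.
split=> [xy|xy].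
  rewrite -[x](subrK y) -[in RHS](add0r y); apply: z3_congrD => //.
  by rewrite xy z3_0.
by rewrite -(z3_0 n) -(subrr y); apply: z3_congrD.
Qed.

Lemma z3_congr_le (x y : Z3) m n : (m <= n)%N -> x n = y n -> x m = y m.
Proof.
by move=> mn /z3_subr_eq0 xy; apply/z3_subr_eq0; apply: z3res_eq0_le xy.
Qed.

Lemma z3_nat k n : (k%:R : Z3) n = (k %% 3 ^+ n)%Z.
Proof.
elim: k => [|k IHk]; first by rewrite mulr0n z3_0 mod0z.
by rewrite -addn1 natrD /= IHk modzDm PoszD.
Qed.

(** An equality of integers, not only a congruence: three times a representative in [0, 3^n) lies in
    [0, 3^(n+1)). *)
Lemma z3_mul3 (x : Z3) n : (3 * x) n.+1 = 3 * x n.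
Proof.
have -> : (3 * x) n.+1 = (((3 : Z3) n.+1 * x n.+1) %% 3 ^+ n.+1)%Z by [].
by rewrite (z3_nat 3) modzMml exprS -mulz_modr// -z3resP.
Qed.

Lemma z3_addM3_res1 (a x : Z3) : (a + 3 * x) 1%N = a 1%N.
Proof.
by apply/z3_subr_eq0; rewrite addrAC subrr add0r z3_mul3 z3res0 mulr0.
Qed.

Lemma z3_congr3 (x y : Z3) n : (3 * x) n.+1 = (3 * y) n.+1 <-> x n = y n.
Proof. by rewrite !z3_mul3; split=> [/mulfI|->] //; apply. Qed.

Lemma z3_mul3I (x y : Z3) : 3 * x = 3 * y -> x = y.
Proof. by move=> xy; apply: z3_inj => n; apply/z3_congr3; rewrite xy. Qed.

Lemma z3_mul3XI k (x y : Z3) : 3 ^+ k * x = 3 ^+ k * y -> x = y.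
Proof.
elim: k => [|k IHk]; first by rewrite !mul1r.
by rewrite !exprS -!mulrA => /z3_mul3I.
Qed.

Lemma z3_divK3 (x : Z3) n : x 1%N = 0 -> x n.+1 = 3 * (x n.+1 %/ 3)%Z.
Proof.
move=> x1; rewrite mulrC divzK//; apply/dvdz_mod0P.
elim: n => [|n IHn]; first by rewrite x1.
rewrite (divz_eq (x n.+2) (3 ^+ n.+1)) -z3resP exprSr mulrA modzMDl.
exact: IHn.
Qed.

(** Division by 3 costs one digit: the quotient mod 3^n is read off [x] mod 3^(n+1). *)
Lemma z3_div3_proof (x : Z3) (x1 : x 1%N = 0) n :
  (x n.+1 %/ 3)%Z = ((x n.+2 %/ 3)%Z %% 3 ^+ n)%Z.
Proof.
apply: (@mulfI _ (3 : int)) => //.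
by rewrite -z3_divK3// mulz_modr// -exprS -z3_divK3// -z3resP.
Qed.

Lemma z3_dvd3 (x : Z3) : x 1%N = 0 -> exists y, x = 3 * y.
Proof.
move=> x1; exists (MkZ3 (z3_div3_proof x1)); apply: z3_inj => -[|n].
  by rewrite !z3res0.
by rewrite z3_mul3 /= -z3_divK3.
Qed.

Lemma div3K (x : Z3) : div3 (3 * x) = x.
Proof.
rewrite /div3; case: xgetP => [y _ /= /z3_mul3I //|/(_ x)].
by case.
Qed.

Lemma z3_val1 (x : Z3) : [\/ x 1%N = 0, x 1%N = 1 | x 1%N = 2].
Proof.
have : 0 <= x 1%N < 3.
  by rewrite -(z3res_small x) modz_ge0// ltz_pmod.
case: (x 1%N) => [[|[|[|//]]]|//] _; [exact: Or31|exact: Or32|exact: Or33].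
Qed.

(** * Contractions, units and the absence of zero divisors *)

(** After n steps the iterates from any two starting points agree mod 3^n, so the residues mod 3^n
    of the n-th iterates are compatible and define the limit. *)
Lemma contraction_fixpoint (T : Z3 -> Z3) :
  (forall (x y : Z3) n, x n = y n -> (T x) n.+1 = (T y) n.+1) ->
  exists x, T x = x.
Proof.
move=> Tc.
have iter_congr (x y : Z3) n : (iter n T x) n = (iter n T y) n.
  by elim: n => [|n IHn]; [rewrite !z3res0 | exact: Tc].
have fixP n :
    (iter n T 0%R) n = ((iter n.+1 T 0%R) n.+1 %% 3 ^+ n)%Z.
  by rewrite -z3resP iterSr; exact: iter_congr.
exists (MkZ3 fixP); apply: z3_inj => n /=.
(* Starting at [T 0] instead of 0 turns the n-th iterate into [T] of the n-th iterate from 0. *)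
rewrite (iter_congr 0 (T 0)) -iterSr iterS.
by apply: (@z3_congr_le _ _ n n.+1) => //; apply: Tc.
Qed.

(** Both nonzero residues have square 1 mod 3, so x^2 = 1 + 3k. The inverse y of 1 + 3k is the fixed
    point of the contraction y |-> 1 - 3ky, and x y inverts x. *)
Lemma z3_inv (x : Z3) : x 1%N != 0 -> exists y, x * y = 1.
Proof.
move=> x1; have [k kE] : exists k, x * x = 1 + 3 * k.
  have [|k ek] := @z3_dvd3 (x * x - 1); last first.
    by exists k; rewrite -ek addrC subrK.
  apply/z3_subr_eq0; move: x1 => /=.
  by case: (z3_val1 x) => ->.
have [|y yE] := @contraction_fixpoint (fun y => 1 - 3 * (k * y)).
  move=> a b n ab; apply: z3_congrD => //; apply: z3_congrN.
  by apply/z3_congr3/z3_congrM.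
exists (x * y); rewrite mulrA kE -[in RHS](subrK (3 * (k * y)) 1) yE.
by ring.
Qed.

Lemma z3_unit_congr (u x y : Z3) n :
  u 1%N != 0 -> (u * x) n = (u * y) n -> x n = y n.
Proof.
move=> /z3_inv[v uv] xy; rewrite -(mul1r x) -(mul1r y) -uv (mulrC u v) -!mulrA.
exact: z3_congrM.
Qed.

Lemma z3_unitI (u x y : Z3) : u 1%N != 0 -> u * x = u * y -> x = y.
Proof.
by move=> u1 xy; apply: z3_inj => n; apply: (z3_unit_congr u1); rewrite xy.
Qed.

Lemma z3_eq0P (x : Z3) : x <> 0 -> exists n, x n.+1 != 0.
Proof.
case: (z3abs_cases x) => [[-> //]|[n [_ xn _]]] _.
by exists n.
Qed.

(** Factors 3 are stripped from a nonzero [x] until it is a unit; the induction is on an index at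
    which [x] has a nonzero residue. *)
Lemma z3_mulf_eq0 (x y : Z3) : x * y = 0 -> x = 0 \/ y = 0.
Proof.
move=> xy0; have [x0|/z3_eq0P[n xn]] := pselect (x = 0); [by left|right].
elim: n x xy0 xn => [|n IHn] x xy0 xn.
  by apply: (z3_unitI xn); rewrite mulr0.
case: (eqVneq (x 1%N) 0) => [/z3_dvd3[x' ex]|x1]; last first.
  by apply: (z3_unitI x1); rewrite mulr0.
subst x; apply: (IHn x').
  by apply: z3_mul3I; rewrite mulr0 mulrA.
by apply: contraNneq xn => h; rewrite z3_mul3 h.
Qed.

(** * Absolute value and continuity in terms of residues *)

Lemma z3abs_eq (x y : Z3) :
  (forall n, x n = 0 <-> y n = 0) -> z3abs x = z3abs y.
Proof.
move=> xy; case: (z3abs_cases x) => [[ex ->]|[m [xm xSm ->]]].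
  suff -> : y = 0 by rewrite z3abs0.
  by apply: z3_inj => n; rewrite z3_0; apply/xy; rewrite ex z3_0.
apply/le_anti; rewrite z3abs_le; apply/andP; split; last exact/eqP/xy.
have ySm : y m.+1 != 0 by apply: contra_neq xSm => /xy.
case: (z3abs_cases y) => [[ey _]|[n [yn ySn ->]]].
  by rewrite ey z3_0 eqxx in ySm.
rewrite lef_pV2 ?posrE ?exprn_gt0// ler_eXn2l// leqNgt.
by apply: contra ySm => mn; apply/eqP/(z3res_eq0_le mn).
Qed.

Lemma continuousZ3P (f : Z3 -> Z3) : continuous f <->
  forall (x : Z3) m, exists n, forall y : Z3, x n = y n -> (f x) m = (f y) m.
Proof.
have lt_res (x : Z3) m : z3abs x < 3 ^- m -> x m = 0.
  by move=> /ltW; rewrite z3abs_le => /eqP.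
have arch (e : rat) : 0 < e -> exists n, 3 ^- n < e :> rat.
  move=> e0; have /archi_boundP : 0 <= e^-1 by rewrite invr_ge0 ltW.
  set N := Num.bound _ => eN; exists N.
  rewrite invf_plt ?posrE ?exprn_gt0// (lt_trans eN)//.
  by rewrite -natrX ltr_nat ltn_expl.
split=> [fc x m|fc x].
  have := fc x => /(@cvg_ballP rat Z3).
  have m0 : 0 < 3 ^- m :> rat by rewrite invr_gt0 exprn_gt0.
  move=> /(_ _ m0) /(@nbhs_ballP rat Z3)[e /= e0 be].
  have [n ne] := arch e e0; exists n => y xy.
  have : ball x e y.
    rewrite ballEmdist /=; apply: le_lt_trans ne.
    rewrite [X in X <= _](_ : _ = z3abs (x - y))// z3abs_le.
    exact/eqP/z3_subr_eq0.
  by move=> /be; rewrite /= ballEmdist /= => /lt_res/z3_subr_eq0.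
apply/(@cvg_ballP rat Z3 _ (nbhs x) (nbhs_filter x)) => e e0.
apply/(@nbhs_ballP rat Z3).
have [m me] := arch e e0; have [n fn] := fc x m.
exists (3 ^- n); first by rewrite /= invr_gt0 exprn_gt0.
move=> y; rewrite ballEmdist /= => /lt_res/z3_subr_eq0/fn fxy.
rewrite ballEmdist /=; apply: le_lt_trans me.
rewrite [X in X <= _](_ : _ = z3abs (f x - f y))// z3abs_le.
exact/eqP/z3_subr_eq0.
Qed.

(** The natural numbers are dense: the representative of [x] mod 3^N is one of them, congruent to
    [x]. This yields the uniqueness of iota_q. *)
Lemma continuous_nat_eq (f g : Z3 -> Z3) : continuous f -> continuous g ->
  (forall n : nat, f n%:R = g n%:R) -> f = g.
Proof.
move=> /continuousZ3P fc /continuousZ3P gc fg; apply/funext => x.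
apply: z3_inj => m; have [a fa] := fc x m; have [b gb] := gc x m.
pose k := `|x (maxn a b)|%N.
have xk : x (maxn a b) = (k%:R : Z3) (maxn a b).
  rewrite z3_nat /k gez0_abs ?z3res_small//.
  by rewrite -(z3res_small x) modz_ge0// expf_eq0 andbF.
rewrite (fa k%:R) ?fg 1?(gb k%:R)//; apply: z3_congr_le xk.
  exact: leq_maxr.
exact: leq_maxl.
Qed.

(** * The 3-adic size of 3^j / (j+2)! *)

(* Legendre's formula, with [2 * (m %/ 3) + m %/ 3 <= m] telescoped. *)
Lemma logn3_fact n : (0 < n)%N -> (2 * logn 3 n`! < n)%N.
Proof.
move=> n0; rewrite logn_fact//.
have sum_le L : (2 * \sum_(1 <= k < L.+1) n %/ 3 ^ k + n %/ 3 ^ L <= n)%N.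
  elim: L => [|L IHL]; first by rewrite big_nil divn1.
  apply: leq_trans IHL; rewrite big_nat_recr//= mulnDr -addnA leq_add2l.
  by rewrite -mulSnr expnSr divnMA mulnC leq_divM.
suff sum_lt L : (2 * \sum_(1 <= k < L.+1) n %/ 3 ^ k < n)%N by exact: sum_lt.
elim: L => [|L IHL]; first by rewrite big_nil muln0.
(* Strictness: either the new summand is 0 and the sum does not grow, or it is positive and is the
   slack left by [sum_le]. *)
have := sum_le L.+1; case: (posnP (n %/ 3 ^ L.+1)) => [nL _|nL].
  by rewrite big_nat_recr//= nL addn0.
by apply: leq_trans; rewrite -addn1 leq_add2l.
Qed.

(** Write (j+2)! = 3^v m with m a unit. By [logn3_fact], v is at most [(j.+1)./2], and j = [j./2] +
    [(j.+1)./2], so 3^j / (j+2)! still contains 3^(j./2). *)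
Lemma coef_exists j :
  exists c : Z3, (j.+2)`!%:R * (3 ^+ j./2 * c) = 3 ^+ j.
Proof.
have [m m3 mE] := pfactor_coprime (isT : prime 3) (fact_gt0 j.+2).
have [d md] : exists d : Z3, m%:R * d = 1.
  apply: z3_inv; rewrite z3_nat expr1.
  by move: m3; rewrite prime_coprime// /dvdn modz_nat.
have := logn3_fact (ltn0Sn j.+1); set v := logn _ _ in mE *.
rewrite mul2n ltnS -geq_half_double => vj.
exists (3 ^+ ((j.+1)./2 - v) * d).
have -> : 3 ^+ j = 3 ^+ (v + (j./2 + ((j.+1)./2 - v))).
  by rewrite addnCA subnKC// -uphalfE uphalf_half addnCA addnn odd_double_half.
rewrite mE natrM natrX !exprD -[RHS]mul1r -[X in _ = X * _]md.
by ring.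
Qed.

(* [3 ^+ j./2 * coef j = 3 ^+ j / (j + 2)!]: the explicit power of 3 is what
   makes the series below converge. *)
Definition coef j : Z3 :=
  xget 0 [set c | (j.+2)`!%:R * (3 ^+ j./2 * c) = 3 ^+ j].

Lemma coefP j : (j.+2)`!%:R * (3 ^+ j./2 * coef j) = 3 ^+ j.
Proof. exact: (xgetPex 0 (coef_exists j)). Qed.

Lemma two_unit : (2 : Z3) 1%N != 0.
Proof. by rewrite (z3_nat 2). Qed.

Lemma coef0P : 2 * coef 0 = 1.
Proof. by have := coefP 0; rewrite !expr0 mul1r. Qed.

(** Both are 1/2, since 3/3! = 1/2!. *)
Lemma coef1E : coef 1 = coef 0.
Proof.
apply: (z3_unitI two_unit); apply: z3_mul3I.
have := coefP 1; rewrite expr1 mul1r => c1.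
rewrite coef0P mulr1 -[RHS]c1 mulrA -natrM.
by [].
Qed.

(** By [coefP] the factorial divides 3^j, and powers of 3 can be cancelled. *)
Lemma fact_mulI j (x y : Z3) :
  (j.+2)`!%:R * x = (j.+2)`!%:R * y -> x = y.
Proof.
move=> xy; apply: (@z3_mul3XI j); rewrite -coefP.
by rewrite mulrAC xy mulrAC.
Qed.

(** * Series in powers of 3 *)

Lemma z3_mul3X0 n (x : Z3) : (3 ^+ n * x) n = 0.
Proof.
elim: n => [|n IHn]; first exact: z3res0.
by rewrite exprS -mulrA z3_mul3 IHn.
Qed.

Lemma z3_series_proof (a : nat -> Z3) n :
  (\sum_(i < n) 3 ^+ i * a i : Z3) n
  = ((\sum_(i < n.+1) 3 ^+ i * a i : Z3)%R n.+1 %% 3 ^+ n)%Z.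
Proof.
rewrite -z3resP big_ord_recr -[LHS]/(_ n); apply/esym/z3_subr_eq0.
rewrite addrC addKr; exact: z3_mul3X0.
Qed.

(* [z3_series a] is the sum of all the [3 ^+ i * a i]. *)
Definition z3_series a : Z3 := MkZ3 (z3_series_proof a).

Lemma z3_series_rec a : z3_series a = a 0%N + 3 * z3_series (a \o S).
Proof.
apply: z3_inj => -[|n]; first by rewrite !z3res0.
rewrite [LHS]/= big_ord_recl expr0 mul1r; apply: z3_congrD => //.
rewrite (eq_bigr (fun i : 'I_n => 3 * (3 ^+ i * a i.+1))); last first.
  by move=> i _; rewrite lift0 exprS mulrA.
by rewrite -mulr_sumr; apply/z3_congr3.
Qed.

Lemma z3_series_congr (a b : nat -> Z3) n :
  (forall i, a i n = b i n) -> z3_series a n = z3_series b n.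
Proof. by move=> ab; apply: z3_congr_sum => i; apply: z3_congrM. Qed.

Lemma z3_series_finite a N : (forall i, (N <= i)%N -> a i = 0) ->
  z3_series a = \sum_(i < N) 3 ^+ i * a i.
Proof.
elim: N a => [|N IHN] a a0.
  rewrite big_ord0; apply: z3_inj => n /=.
  by rewrite big1// => i _; rewrite a0// mulr0.
rewrite z3_series_rec IHN => [|i Ni]; last exact: a0.
rewrite big_ord_recl expr0 mul1r mulr_sumr; congr (_ + _).
by apply: eq_bigr => i _; rewrite lift0 exprS mulrA.
Qed.

(** * The series h and its tail *)

Definition term (z u : Z3) j : Z3 :=
  coef j * (\prod_(i < j) (z - 2 - i%:R)) * u ^+ j.

(** The j-th summand of h is [3 ^+ j./2 * term z u j]. Those for j = 2i and j = 2i+1 share the power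
    3^i, and pairing them gives the shape that [z3_series] expects. *)
Definition pair_term z u i : Z3 := term z u i.*2 + term z u i.*2.+1.

(* [(iota_q z - z) / ((q - 1) z (z - 1))] for [q = 1 + 3 u]. *)
Definition iota_quot z u : Z3 := z3_series (pair_term z u).

(** The summands of h with j >= 2, divided by 3; the r of the overview is [2 * iota_tail z u]. *)
Definition iota_tail z u : Z3 := z3_series (pair_term z u \o S).

Lemma pair_term_congr (z z' u u' : Z3) i n : z n = z' n -> u n = u' n ->
  pair_term z u i n = pair_term z' u' i n.
Proof.
move=> zz' uu'; have term_congr j : term z u j n = term z' u' j n.
  apply: z3_congrM; last exact: z3_congrX.
  apply: z3_congrM => //; apply: z3_congr_prod => k.
  by do 2!apply: z3_congrD => //.
exact: z3_congrD.
Qed.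

Lemma iota_quot_congr (z z' u u' : Z3) n : z n = z' n -> u n = u' n ->
  iota_quot z u n = iota_quot z' u' n.
Proof.
by move=> zz' uu'; apply: z3_series_congr => i; apply: pair_term_congr.
Qed.

Lemma iota_tail_congr (z z' u u' : Z3) n : z n = z' n -> u n = u' n ->
  iota_tail z u n = iota_tail z' u' n.
Proof.
by move=> zz' uu'; apply: z3_series_congr => i; apply: pair_term_congr.
Qed.

(** The leading pair is (1 + (z-2)u)/2, and doubling clears its denominator. *)
Lemma iota_quot_rec z u :
  2 * iota_quot z u = 1 + (z - 2) * u + 3 * (2 * iota_tail z u).
Proof.
rewrite /iota_quot z3_series_rec -/(iota_tail z u) /pair_term /term coef1E.
rewrite big_ord0 big_ord_recl big_ord0 expr0 expr1 /= subr0 !mulr1 mulrDr.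
rewrite double0 -[1 + (z - 2) * u]mul1r -[X in _ = X * _ + _]coef0P.
by ring.
Qed.

Lemma iota_quot_eq0 z u :
  iota_quot z u = 0 <-> (z - 2) * u = - 1 - 3 * (2 * iota_tail z u).
Proof.
split=> [h|h].
  have := iota_quot_rec z u; rewrite h mulr0 => /esym/eqP.
  rewrite addrAC addr_eq0 => /eqP h'.
  by rewrite -[LHS]opprK -h' opprD.
apply: (z3_unitI two_unit); rewrite mulr0 iota_quot_rec h.
by ring.
Qed.

(** * Agreement with iota_q on the natural numbers *)

(** Multiplied by (j+2)!, both sides become the falling factorial of m+2 of length j+2 times
    (3u)^(j+1). *)
Lemma bin_term m (u : Z3) j :
  3 * u * (m.+2%:R * (m.+2%:R - 1)) * (3 ^+ j./2 * term m.+2%:R u j)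
  = 'C(m.+2, j.+2)%:R * (3 * u) ^+ j.+1.
Proof.
apply: (@fact_mulI j).
have ffactE : (m.+2 ^_ j.+2)%:R =
    m.+2%:R * (m.+2%:R - 1) *
    \prod_(i < j) (m.+2%:R - 2 - i%:R) :> Z3.
  have -> : m.+2%:R - 1 = m.+1%:R :> Z3 by rewrite -addn1 natrD addrK.
  have -> : m.+2%:R - 2 = m%:R :> Z3 by rewrite -addn2 natrD addrK.
  rewrite !ffactSS !natrM -mulrA; do 2!congr (_ * _).
  (* For j > m both sides vanish, the product through its factor of index m. *)
  case: (ltnP m j) => [mj|jm].
    by rewrite ffact_small// (bigD1 (Ordinal mj)) //= subrr mul0r.
  rewrite ffact_prod natr_prod; apply: eq_bigr => i _.
  by rewrite natrB// (leq_trans (ltnW (ltn_ord i))).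
rewrite [RHS]mulrA -natrM mulnC bin_ffact ffactE /term !exprMn exprSr.
rewrite -(coefP j) (exprSr u).
move: (\prod_(i < j) _) => P.
move: (u ^+ j) (3 ^+ j./2 : Z3) (coef j) ((j.+2)`!%:R : Z3) => a b c e.
by ring.
Qed.

(** This expands ((1+x)^n - 1)/x by the binomial theorem. The bound [N] may exceed [n], the added
    binomial coefficients being 0. *)
Lemma sum_expr_bin (x : Z3) n N :
  (n <= N)%N -> (forall y : Z3, x * y = 0 -> y = 0) ->
  \sum_(i < n) (1 + x) ^+ i =
  n%:R + \sum_(j < N) 'C(n, j.+2)%:R * x ^+ j.+1.
Proof.
move=> nN xI; apply/eqP; rewrite -subr_eq0; apply/eqP/xI.
apply/eqP; rewrite mulrBr subr_eq0; apply/eqP.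
have {1}-> : x = 1 + x - 1 by rewrite addrC addKr.
rewrite -subrX1 exprDn.
have -> : \sum_(i < n.+1) 1 ^+ (n - i) * x ^+ i *+ 'C(n, i) =
    \sum_(i < N.+2) 'C(n, i)%:R * x ^+ i.
  have nN2 : (n.+1 <= N.+2)%N by rewrite ltnS (leq_trans nN).
  rewrite (big_ord_widen _ (fun i => 1 ^+ (n - i) * x ^+ i *+ 'C(n, i)) nN2).
  rewrite big_mkcond; apply: eq_bigr => i _.
  rewrite ltnS expr1n mul1r mulr_natl.
  by case: leqP => // ni; rewrite bin_small.
rewrite !big_ord_recl /= bin0 expr0 mulr1 addrC addKr /bump /= !add1n bin1.
rewrite expr1 mulrDr [x * _]mulrC mulr_sumr; congr (_ + _).
apply: eq_bigr => i _.
by rewrite !add1n exprS mulrCA.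
Qed.

Definition iota_fun u z : Z3 := z + 3 * u * (z * (z - 1)) * iota_quot z u.

Lemma iota_fun_nat (u : Z3) (n : nat) : u 1%N != 0 ->
  iota_fun u n%:R = \sum_(i < n) (1 + 3 * u) ^+ i.
Proof.
move=> u1.
have uI y : 3 * u * y = 0 -> y = 0.
  rewrite -mulrA => h; apply: (z3_unitI u1); apply: z3_mul3I.
  by rewrite h !mulr0.
(* At 0 and 1 the factor z(z-1) kills the series; from 2 on the series terminates and is compared
   with the binomial sum. *)
rewrite /iota_fun; case: n => [|[|m]].
- by rewrite big_ord0 !mul0r mulr0 mul0r addr0.
- by rewrite big_ord_recl big_ord0 subrr !mulr0 mul0r.
(* An even number of summands is taken, to match the pairs. *)
rewrite (@sum_expr_bin _ _ m.+2.*2) // -?addnn ?leq_addr//; congr (_ + _).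
have P0 j : (m < j)%N -> term m.+2%:R u j = 0.
  move=> mj; rewrite /term (bigD1 (Ordinal mj)) //= -addn2 natrD addrK subrr.
  by rewrite mul0r mulr0 mul0r.
rewrite /iota_quot (@z3_series_finite _ m.+2) => [|i mi]; last first.
  have mi2 : (m < i.*2)%N by rewrite -addnn (ltn_addl i (ltnW mi)).
  by rewrite /pair_term !P0 ?addr0// ltnW.
suff sumE k :
    \sum_(i < k) 3 * u * (m.+2%:R * (m.+2%:R - 1)) *
      (3 ^+ i * pair_term m.+2%:R u i) =
    \sum_(j < k.*2) 'C(m.+2, j.+2)%:R * (3 * u) ^+ j.+1.
  by rewrite mulr_sumr addnn sumE.
elim: k => [|k IHk]; first by rewrite !big_ord0.
rewrite doubleS !big_ord_recr /= IHk -addrA; congr (_ + _).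
rewrite /pair_term [3 ^+ k * _]mulrDr [LHS]mulrDr -!bin_term.
by rewrite /= doubleK uphalf_double.
Qed.

(** [iota_fun u] is continuous and has the prescribed values on the naturals, so [xget] returns a
    function with these properties, and density makes the two equal. *)
Lemma iota3E (u : Z3) : u 1%N != 0 -> iota3 (1 + 3 * u) = iota_fun u.
Proof.
move=> u1; pose P := [set f : Z3 -> Z3 | continuous f /\
  forall n : nat, f n%:R = \sum_(i < n) (1 + 3 * u) ^+ i].
have Piota : P (iota_fun u).
  split; last by move=> n; exact: iota_fun_nat.
  apply/continuousZ3P => x m; exists m => y xy.
  apply: z3_congrD => //; apply: z3_congrM; last exact: iota_quot_congr.
  apply: z3_congrM => //; apply: z3_congrM => //.
  exact: z3_congrD.
have [fc fn] : P (iota3 (1 + 3 * u)) := xgetI (fun=> 0) Piota.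
apply: continuous_nat_eq fc (proj1 Piota) _ => n.
by rewrite fn -(proj2 Piota).
Qed.

(** * Fixed points as zeros of [iota_quot] *)

Lemma nontrivial_fixed_pointsE (u : Z3) : u 1%N != 0 ->
  nontrivial_fixed_points (1 + 3 * u) =
  [set z | iota_quot z u = 0 /\ z <> 0 /\ z <> 1].
Proof.
move=> u1; apply/seteqP; split=> z [] hz [z0 z1]; split=> //; last first.
  by rewrite iota3E// /iota_fun hz mulr0 addr0.
move: hz; rewrite iota3E// /iota_fun => /(canRL (addKr _)).
rewrite addNr -!mulrA => h.
have {}h : z * ((z - 1) * iota_quot z u) = 0.
  by apply: (z3_unitI u1); apply: z3_mul3I; rewrite h !mulr0.
case/z3_mulf_eq0: h => // /z3_mulf_eq0[/eqP|//].
by rewrite subr_eq0 => /eqP.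
Qed.

Lemma z3_sub2_res1 (z : Z3) : (z - 2) 1%N = ((z 1%N - 2) %% 3)%Z.
Proof.
have -> : (z - 2) 1%N =
  ((z 1%N + (- (2 : Z3) 1%N %% 3 ^+ 1)%Z) %% 3 ^+ 1)%Z by [].
by rewrite (z3_nat 2) expr1; case: (z3_val1 z) => ->.
Qed.

(** Mod 3 the equation is (z-2)u = -1. The two solutions account for the classes 7 and 4 of q = 1 +
    3u mod 9. *)
Lemma iota_quot_eq0_res (z u : Z3) : iota_quot z u = 0 ->
  z 1%N = 0 /\ u 1%N = 2 \/ z 1%N = 1 /\ u 1%N = 1.
Proof.
move=> /iota_quot_eq0 h; have : ((z - 2) * u) 1%N = (-1 : Z3) 1%N.
  by rewrite h -mulrN z3_addM3_res1.
have -> : ((z - 2) * u) 1%N = ((z - 2)%R 1%N * u 1%N %% 3)%Z by [].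
rewrite z3_sub2_res1.
by case: (z3_val1 z) => ->; case: (z3_val1 u) => -> //; [left|right].
Qed.

Lemma iota_quot_eq0_u_unit (z u : Z3) : iota_quot z u = 0 -> u 1%N != 0.
Proof. by move=> /iota_quot_eq0_res[] [_ ->]. Qed.

Lemma z_sub2_unit (z : Z3) : z 1%N = 0 \/ z 1%N = 1 -> (z - 2) 1%N != 0.
Proof.
by rewrite z3_sub2_res1 => -[] ->.
Qed.

(** Dividing by the unit u turns the equation into a fixed-point equation for z; the factor 3 before
    the tail makes it a contraction. *)
Lemma iota_quot_eq0_z_exists (u : Z3) :
  u 1%N != 0 -> exists z, iota_quot z u = 0.
Proof.
move=> /z3_inv[v uv].
have [|z zE] := @contraction_fixpoint
    (fun z => 2 + v * (- 1 - 3 * (2 * iota_tail z u))).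
  move=> x y n xy; apply: z3_congrD => //; apply: z3_congrM => //.
  apply: z3_congrD => //; apply/z3_congrN/z3_congr3/z3_congrM => //.
  exact: iota_tail_congr.
exists z; apply/iota_quot_eq0.
have -> : z - 2 = v * (- 1 - 3 * (2 * iota_tail z u)).
  by rewrite -{1}zE addrC addKr.
rewrite mulrAC [v * u]mulrC uv.
by rewrite mul1r.
Qed.

Lemma iota_quot_eq0_u_exists (z : Z3) : z 1%N = 0 \/ z 1%N = 1 ->
  exists u, iota_quot z u = 0.
Proof.
move=> /z_sub2_unit/z3_inv[v uv].
have [|u uE] := @contraction_fixpoint
    (fun u => v * (- 1 - 3 * (2 * iota_tail z u))).
  move=> x y n xy; apply: z3_congrM => //.
  apply: z3_congrD => //; apply/z3_congrN/z3_congr3/z3_congrM => //.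
  exact: iota_tail_congr.
by exists u; apply/iota_quot_eq0; rewrite -{1}uE [LHS]mulrA uv mul1r.
Qed.

(* Two zeros congruent mod 3^n have [3 * iota_tail] congruent mod 3^(n+1), so
   mod 3^(n+1) the equation is [(z - 2) * u = (z' - 2) * u'], with both factors
   units. *)
Lemma iota_quot_eq0_congr (z z' u u' : Z3) n :
  iota_quot z u = 0 -> iota_quot z' u' = 0 ->
  z n = z' n <-> u n = u' n.
Proof.
move=> h h'; elim: n => [|n IHn]; first by rewrite !z3res0.
have := h => /iota_quot_eq0 e; have := h' => /iota_quot_eq0 e'.
have eS : z n = z' n -> u n = u' n ->
    ((z - 2) * u) n.+1 = ((z' - 2) * u') n.+1.
  move=> zz' uu'; rewrite e e'; apply: z3_congrD => //; apply: z3_congrN.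
  by apply/z3_congr3/z3_congrM => //; apply: iota_tail_congr.
have u1 := iota_quot_eq0_u_unit h.
have z1 : (z - 2) 1%N != 0.
  by apply: z_sub2_unit; case: (iota_quot_eq0_res h) => -[]; [left|right].
split=> eqS.
  have eqn := z3_congr_le (leqnSn n) eqS.
  apply: (z3_unit_congr z1); rewrite eS//; last exact/IHn.
  by apply: z3_congrM => //; apply: z3_congrD.
have eqn := z3_congr_le (leqnSn n) eqS.
suff : (z - 2) n.+1 = (z' - 2) n.+1.
  by move=> /(z3_congrD (erefl ((2 : Z3) n.+1))); rewrite ![2 + _]addrC !subrK.
apply: (z3_unit_congr u1); rewrite mulrC eS//; last exact/IHn.
by rewrite mulrC; apply: z3_congrM.
Qed.

Lemma iota_quot_eq0_z_unique (z z' u : Z3) :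
  iota_quot z u = 0 -> iota_quot z' u = 0 -> z = z'.
Proof.
by move=> h h'; apply: z3_inj => n; apply/(iota_quot_eq0_congr n h h').
Qed.

Lemma iota_quot_eq0_u_unique (z u u' : Z3) :
  iota_quot z u = 0 -> iota_quot z u' = 0 -> u = u'.
Proof.
by move=> h h'; apply: z3_inj => n; apply/(iota_quot_eq0_congr n h h').
Qed.

(** * The exceptional parameters and [Phi] *)

(** Having no nontrivial fixed point means that the zero of h is 0 or 1. Since 0 and 1 differ mod 3,
    the class of q mod 9 decides which, and the zero determines u. *)
Lemma exceptionalE (a z u : Z3) : (z = 0 \/ z = 1) -> iota_quot z u = 0 ->
  (exists x, u = a + 3 * x) -> exceptional (1 + 3 * a) = 1 + 3 * u.
Proof.
move=> z01 hzu [x ux].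
have u1 := iota_quot_eq0_u_unit hzu.
have U12 (v : Z3) : v 1%N != 0 -> (U 1 `\` U 2) (1 + 3 * v).
  move=> v1; split; first by exists v; rewrite ?expr1.
  case=> y _ /addrI; rewrite exprS expr1 -mulrA => /z3_mul3I vy.
  by move: v1; rewrite -vy -(expr1 3) z3_mul3X0.
rewrite /exceptional; case: xgetP => [q _ /= [[[v _ vE] _] [[y _ yq] nfp]]|].
  rewrite expr1 in vE; rewrite -{q}vE in yq nfp *.
  have va : v = a + 3 * y.
    by apply: z3_mul3I; apply: (addrI 1); rewrite -yq; ring.
  have v1 : v 1%N != 0.
    by rewrite va z3_addM3_res1 -(z3_addM3_res1 a x) -ux.
  have [z' hz'] := iota_quot_eq0_z_exists v1.
  have z'01 : z' = 0 \/ z' = 1.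
    apply: contrapT => /not_orP[z'0 z'1].
    have : nontrivial_fixed_points (1 + 3 * v) z'.
      by rewrite nontrivial_fixed_pointsE.
    by rewrite nfp.
  suff zz' : z = z' by subst z'; rewrite (iota_quot_eq0_u_unique hzu hz').
  have uv1 : v 1%N = u 1%N.
    by rewrite va ux !z3_addM3_res1.
  have /(iota_quot_eq0_congr 1 hz' hzu) := uv1.
  by case: z01 z'01 => -> [] ->.
(* The default of [xget] is excluded, because [1 + 3 * u] itself qualifies. *)
move/(_ (1 + 3 * u)) => []; split; first exact: U12.
split; first by exists x => //; rewrite ux; ring.
rewrite nontrivial_fixed_pointsE//; apply/seteqP; split=> // z' [hz'].
by rewrite (iota_quot_eq0_z_unique hz' hzu); case: z01 => -> [].
Qed.

Lemma q0E : exists2 u, iota_quot 0 u = 0 & q0 = 1 + 3 * u.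
Proof.
have [|u hu] := @iota_quot_eq0_u_exists 0; first by left; rewrite z3_0.
(* The choice of [a] reflects 7 = 1 + 3 * 2. *)
exists u => //; rewrite -(exceptionalE (a := 2) _ hu); [|by left|].
  by congr exceptional; ring.
have [|x xE] := @z3_dvd3 (u - 2); last by exists x; rewrite -xE addrC subrK.
apply/z3_subr_eq0; rewrite (z3_nat 2).
by case: (iota_quot_eq0_res hu) => -[]; rewrite ?z3_0.
Qed.

Lemma q1E : exists2 u, iota_quot 1 u = 0 & q1 = 1 + 3 * u.
Proof.
have [|u hu] := @iota_quot_eq0_u_exists 1; first by right; rewrite (z3_nat 1).
exists u => //; rewrite -(exceptionalE (a := 1) _ hu); [|by right|].
  by congr exceptional; ring.
have [|x xE] := @z3_dvd3 (u - 1); last by exists x; rewrite -xE addrC subrK.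
apply/z3_subr_eq0; rewrite (z3_nat 1).
by case: (iota_quot_eq0_res hu) => -[]; rewrite ?(z3_nat 1).
Qed.

(** The values 0 at [q0] and 1 at [q1] are exactly the zeros of h there. Elsewhere the zero is
    neither 0 nor 1, hence a nontrivial fixed point, and [xget] does not fall back on its
    default. *)
Lemma iota_quot_Phi (u : Z3) : u 1%N != 0 -> iota_quot (Phi (1 + 3 * u)) u = 0.
Proof.
move=> u1; have [u0 hu0 e0] := q0E; have [u1' hu1 e1] := q1E.
rewrite /Phi e0 e1; case: eqP => [/addrI/z3_mul3I -> //|ne0].
case: eqP => [/addrI/z3_mul3I -> //|ne1].
have [z hz] := iota_quot_eq0_z_exists u1.
suff : nontrivial_fixed_points (1 + 3 * u) z.
  by move=> /(xgetI 0); rewrite nontrivial_fixed_pointsE// => -[].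
rewrite nontrivial_fixed_pointsE//; split=> //; split=> ez; subst z.
  by apply: ne0; rewrite (iota_quot_eq0_u_unique hz hu0).
by apply: ne1; rewrite (iota_quot_eq0_u_unique hz hu1).
Qed.

(** * The isometries *)

(** The pair (a, b) = (1, 1) serves [F] and (0, 2) serves [G]. Surjectivity comes from solving h = 0
    for u, preservation of distance from [iota_quot_eq0_congr]. *)
Lemma isometry_div3_Phi (a b : Z3) :
  a 1%N = 1 /\ b 1%N = 1 \/ a 1%N = 0 /\ b 1%N = 2 ->
  isometry (fun x : Z3 => div3 (Phi (1 + 3 * (b + 3 * x)) - a)).
Proof.
move=> ab.
have hP x : iota_quot (Phi (1 + 3 * (b + 3 * x))) (b + 3 * x) = 0.
  by apply: iota_quot_Phi; rewrite z3_addM3_res1; case: ab => -[_ ->].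
(* The value of [Phi] is congruent to [a] mod 3, so [div3] is an exact division here. *)
have PE x : Phi (1 + 3 * (b + 3 * x)) =
    a + 3 * div3 (Phi (1 + 3 * (b + 3 * x)) - a).
  have [|y yE] := @z3_dvd3 (Phi (1 + 3 * (b + 3 * x)) - a).
    apply/z3_subr_eq0; have := iota_quot_eq0_res (hP x); rewrite z3_addM3_res1.
    by case: ab => -[-> ->] [] [].
  by rewrite yE div3K -yE [RHS]addrC subrK.
split=> [y _|x y].
  have [|u hu] := @iota_quot_eq0_u_exists (a + 3 * y).
    by rewrite z3_addM3_res1; case: ab => -[-> _]; [right|left].
  have [|x xE] := @z3_dvd3 (u - b).
    apply/z3_subr_eq0; have := iota_quot_eq0_res hu; rewrite z3_addM3_res1.
    by case: ab => -[-> ->] [] [].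
  exists x => //; have {xE} uE : u = b + 3 * x by rewrite -xE addrC subrK.
  rewrite uE in hu; rewrite (iota_quot_eq0_z_unique (hP x) hu).
  by rewrite addrC addKr div3K.
rewrite -[LHS]/(z3abs (_ - _)) -[RHS]/(z3abs (_ - _)); apply: z3abs_eq => n.
have addb (c s t : Z3) : (c + 3 * s) n.+1 = (c + 3 * t) n.+1 <-> s n = t n.
  split=> [|st]; last by apply: z3_congrD => //; apply/z3_congr3.
  move=> /(z3_congrD (erefl ((- c) n.+1))); rewrite !addKr.
  by move/z3_congr3.
(* The index is n+1 because both z = a + 3s and u = b + 3x lose one factor 3 on passing to s and
   x. *)
have := iota_quot_eq0_congr n.+1 (hP x) (hP y).
rewrite [in X in X -> _](PE x) [in X in X -> _](PE y) !addb => h.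
by split=> /z3_subr_eq0/h/z3_subr_eq0.
Qed.

Theorem theorem6p6 : isometry F /\ isometry G.
Proof.
split.
  rewrite (_ : F = fun x => div3 (Phi (1 + 3 * (1 + 3 * x)) - 1)).
    by apply: isometry_div3_Phi; left; rewrite (z3_nat 1).
  by apply/funext => x; rewrite /F; congr (div3 (Phi _ - _)); ring.
rewrite (_ : G = fun x => div3 (Phi (1 + 3 * (2 + 3 * x)) - 0)).
  by apply: isometry_div3_Phi; right; rewrite (z3_nat 2) z3_0.
by apply/funext => x; rewrite /G subr0; congr (div3 (Phi _)); ring.
Qed.
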